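(* For every non-negative integer $N$, the Okada monoid $\mathbf{O}_N$ has cardinality $N!$; moreover the map $\sigma\mapsto \mathsf{e}_\sigma$ is a bijection from the symmetric group $\mathfrak{S}_N$ to $\mathbf{O}_N$. For every non-negative integer $N$, every field $\mathbb{K}$ and every choice of parameters $X=(x_1,\dots,x_{N-1})$, $Y=(y_1,\dots,y_{N-2})$ in $\mathbb{K}$, the Okada algebra $\mathbf{O}_N(X,Y)$ has dimension $N!$ over $\mathbb{K}$ and the family $(E_\sigma)_{\sigma\in\mathfrak{S}_N}$ is a basis of it.
   Context: The Okada algebra $\mathbf{O}_N(X,Y)$ is the unital associative $\mathbb{K}$-algebra generated by $E_1,\dots,E_{N-1}$ with relations $E_i^2=x_iE_i$ ($1\le i\le N-1$), $E_iE_j=E_jE_i$ ($|i-j|\ge2$), $E_{i+1}E_iE_{i+1}=y_iE_{i+1}$ ($1\le i\le N-2$). The Okada monoid $\mathbf{O}_N$ is the monoid generated by $\mathsf{e}_1,\dots,\mathsf{e}_{N-1}$ with relations $\mathsf{e}_i^2=\mathsf{e}_i$ ($1\le i\le N-1$), $\mathsf{e}_i\mathsf{e}_j=\mathsf{e}_j\mathsf{e}_i$ ($|i-j|\ge 2$), $\mathsf{e}_{i+1}\mathsf{e}_i\mathsf{e}_{i+1}=\mathsf{e}_{i+1}$ ($1\le i\le N-2$). (For $N\le1$ there are no generators.) The code of $\sigma\in\mathfrak{S}_N$ is $(c_1,\dots,c_N)$ where $c_i=\#\{k<i : \sigma^{-1}(k)>\sigma^{-1}(i)\}$. For a family of generators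 $(g_i)$ (either $g_i=\mathsf{e}_i$ or $g_i=E_i$) one sets $g_\sigma=\prod_{i=1}^N \big(g_{i-1}g_{i-2}\cdots g_{i-c_i}\big)$, the factors being taken from left to right with $i$ increasing (the $i$-th factor has $c_i$ letters, and is $1$ if $c_i=0$). This defines $\mathsf{e}_\sigma$ and $E_\sigma$. *)

(* Defs.v *)
From HB Require Import structures.
From Stdlib Require Import Relations.
From mathcomp Require Import all_boot all_fingroup all_algebra.
From mathcomp Require Import boolp classical_sets cardinality.
From mathcomp.multinomials Require Import monalg.

Set Implicit Arguments.
Unset Strict Implicit.
Unset Printing Implicit Defensive.

Import GRing.Theory.

(* Indices are shifted by one throughout: the generator with label i, for
   1 <= i <= N - 1, is represented by the ordinal i - 1 : 'I_N.-1, and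
   permutations of {1, ..., N} by permutations of 'I_N. *)

Section Word.
Variables (N : nat) (s : 'S_N).

Definition code (i : 'I_N) : nat :=
  #|[set k : 'I_N | (k < i) && ((s^-1)%g i < (s^-1)%g k)]|.

(* The i-th factor g_{i-1} g_{i-2} ... g_{i-c_i} runs through labels; after
   the shift, the ordinal i (label i + 1) contributes the c_i ordinals
   i - 1, i - 2, ..., i - c_i, in this (decreasing) order. *)
Definition code_factor (i : 'I_N) : seq 'I_N.-1 :=
  rev [seq k : 'I_N.-1 <- enum 'I_N.-1 | i - code i <= k < i].

Definition code_word : seq 'I_N.-1 := flatten [seq code_factor i | i <- enum 'I_N].

End Word.

Section OkadaMonoid.
Variable N : nat.
Implicit Types u v w : seq 'I_N.-1.

Inductive okada_rel : seq 'I_N.-1 -> seq 'I_N.-1 -> Prop :=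
| okada_rel_idem (i : 'I_N.-1) : okada_rel [:: i; i] [:: i]
| okada_rel_comm (i j : 'I_N.-1) :
    (i + 2 <= j) || (j + 2 <= i) -> okada_rel [:: i; j] [:: j; i]
| okada_rel_braid (i j : 'I_N.-1) :
    j = i + 1 :> nat -> okada_rel [:: j; i; j] [:: j].

Inductive okada_step : relation (seq 'I_N.-1) :=
| OkadaStep u v w w' :
    okada_rel w w' -> okada_step (u ++ w ++ v) (u ++ w' ++ v).

Definition okada_congr : relation (seq 'I_N.-1) :=
  clos_refl_sym_trans _ okada_step.

Definition okada_congrb u v : bool := `[< okada_congr u v >].

Lemma okada_congrb_equiv : equiv_class_of okada_congrb.
Proof.
split=> [u|u v|v u w]; first by apply/asboolP; exact: rst_refl.
  by apply/asboolP/asboolP; exact: rst_sym.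
by move=> /asboolP uv /asboolP vw; apply/asboolP; exact: rst_trans uv vw.
Qed.

Canonical okada_congrb_equivrel := EquivRelPack okada_congrb_equiv.

Definition okada_monoid : Type := {eq_quot okada_congrb}%qT.
HB.instance Definition _ := Choice.on okada_monoid.
HB.instance Definition _ : EqQuotient _ okada_congrb okada_monoid :=
  EqQuotient.on okada_monoid.

Local Open Scope quotient_scope.

Lemma okada_congr_cat u u' v v' :
  okada_congr u u' -> okada_congr v v' -> okada_congr (u ++ v) (u' ++ v').
Proof.
move=> uu' vv'; apply: (@rst_trans _ _ _ (u' ++ v)).
  elim: uu' => [_ _ [a b w w' ww']|?|? ? _|? ? ? _ uv _ vw].
  - by apply: rst_step; rewrite -!catA; apply: OkadaStep.
  - exact: rst_refl.
  - exact: rst_sym.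
  - exact: rst_trans uv vw.
elim: vv' => [_ _ [a b w w' ww']|?|? ? _|? ? ? _ uv _ vw].
- by apply: rst_step; rewrite !(catA u' a); apply: OkadaStep.
- exact: rst_refl.
- exact: rst_sym.
- exact: rst_trans uv vw.
Qed.

Definition okada_one : okada_monoid := \pi_okada_monoid [::].
Definition okada_mul (x y : okada_monoid) : okada_monoid :=
  \pi_okada_monoid (generic_quotient.repr x ++ generic_quotient.repr y).

Lemma okada_piP u v : reflect (okada_congr u v) (\pi_okada_monoid u == \pi v).
Proof. by rewrite eqmodE; apply: asboolP. Qed.

Lemma okada_pi_cat u v :
  \pi_okada_monoid (u ++ v) = okada_mul (\pi u) (\pi v).
Proof.
by apply/eqP/okada_piP/okada_congr_cat; apply/okada_piP; rewrite reprK.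
Qed.

Fact okada_mulA : associative okada_mul.
Proof.
by elim/quotW=> u; elim/quotW=> v; elim/quotW=> w; rewrite -!okada_pi_cat catA.
Qed.

Fact okada_mul1 : left_id okada_one okada_mul.
Proof. by elim/quotW=> u; rewrite -okada_pi_cat. Qed.

Fact okada_mul1r : right_id okada_one okada_mul.
Proof. by elim/quotW=> u; rewrite -okada_pi_cat cats0. Qed.

HB.instance Definition _ :=
  isMonoid.Build okada_monoid okada_mulA okada_mul1 okada_mul1r.

Definition e_gen (i : 'I_N.-1) : okada_monoid := \pi_okada_monoid [:: i].

Definition e_perm (s : 'S_N) : okada_monoid :=
  (\prod_(k <- code_word s) e_gen k)%g.

End OkadaMonoid.

Local Open Scope ring_scope.

Section FreeAlgebra.
Variables (K : fieldType) (G : choiceType).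

Fact malg_scaleAr (a : K) (f g : {malg K[{fmonom G}]}) : a *: (f * g) = f * (a *: g).
Proof.
have aC (h : {malg K[{fmonom G}]}) : h * a%:MP = a%:MP * h.
  apply: etrans (fgmulgU a mone h) _; apply: etrans (esym (fgmulUg a mone h)).
  by apply: eq_bigr => k _; rewrite mul1m mulm1 mulrC.
by rewrite -(mul_malgC a (f * g)) -(mul_malgC a g) mulrA -aC mulrA.
Qed.

Definition free_alg : Type := {malg K[{fmonom G}]}.
HB.instance Definition _ := GRing.Lalgebra.on free_alg.
HB.instance Definition _ := GRing.Lalgebra_isAlgebra.Build K free_alg malg_scaleAr.

Definition free_gen (i : G) : free_alg := << fmu i >>.

Definition free_const (f : free_alg) : K := mcoeff mone f.

Fact free_const_is_zmod_morphism : zmod_morphism free_const.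
Proof. exact: mcoeffB. Qed.

Fact free_const_is_monoid_morphism : monoid_morphism free_const.
Proof. by split; [exact: (mcoeff1g_is_multiplicative _ _).2
                 |exact: (mcoeff1g_is_multiplicative _ _).1]. Qed.

HB.instance Definition _ := GRing.isZmodMorphism.Build free_alg K free_const
  free_const_is_zmod_morphism.
HB.instance Definition _ := GRing.isMonoidMorphism.Build free_alg K free_const
  free_const_is_monoid_morphism.

Lemma free_const_gen i : free_const (free_gen i) = 0.
Proof.
rewrite /free_const mcoeffU; case: eqP => // /(congr1 val).
by rewrite /= fmU fm1.
Qed.

End FreeAlgebra.

Section QuotientAlgebra.
Variables (K : fieldType) (R : algType K) (S : R -> Prop).

Inductive ideal_gen : R -> Prop :=
| ideal_gen_in f : S f -> ideal_gen f
| ideal_gen0 : ideal_gen 0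
| ideal_genD f g : ideal_gen f -> ideal_gen g -> ideal_gen (f + g)
| ideal_genMl f g : ideal_gen g -> ideal_gen (f * g)
| ideal_genMr f g : ideal_gen f -> ideal_gen (f * g).

Definition ideal_genb (f : R) : bool := `[< ideal_gen f >].

Lemma ideal_genP f : reflect (ideal_gen f) (f \in ideal_genb).
Proof. exact: asboolP. Qed.

Fact ideal_gen_zmod_closed : zmod_closed ideal_genb.
Proof.
split=> [|f g /ideal_genP If /ideal_genP Ig]; apply/ideal_genP.
  exact: ideal_gen0.
by apply: ideal_genD => //; rewrite -mulN1r; apply: ideal_genMl.
Qed.

HB.instance Definition _ :=
  GRing.isZmodClosed.Build R ideal_genb ideal_gen_zmod_closed.

Definition ideal_gen_zmod : zmodClosed R :=
  GRing.ZmodClosed.clone R ideal_genb _.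

Lemma ideal_gen_ker (T : nzRingType) (phi : {rmorphism R -> T}) :
  (forall f, S f -> phi f = 0) -> forall f, ideal_gen f -> phi f = 0.
Proof.
move=> phiS f; elim=> {f} [f /phiS //||f g _ f0 _ g0|f g _ g0|f g _ f0].
- exact: rmorph0.
- by rewrite rmorphD f0 g0 addr0.
- by rewrite rmorphM g0 mulr0.
- by rewrite rmorphM f0 mul0r.
Qed.

(* MathComp algebras are nontrivial, hence the properness argument. *)
Definition alg_quot (S1 : ~ ideal_gen 1) : Type := Quotient.quot ideal_gen_zmod.

Variable S1 : ~ ideal_gen 1.
Local Notation Q := (alg_quot S1).

HB.instance Definition _ := GRing.Zmodule.on Q.
HB.instance Definition _ : EqQuotient _ (Quotient.equiv ideal_gen_zmod) Q :=
  EqQuotient.on Q.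

Local Open Scope quotient_scope.
Local Notation repr := generic_quotient.repr.

Definition alg_pi (f : R) : Q := \pi_Q f.

Lemma alg_piW (P : Q -> Prop) : (forall f, P (alg_pi f)) -> forall u, P u.
Proof. by move=> Ppi u; rewrite -[u]reprK. Qed.

Lemma alg_piP f g : alg_pi f = alg_pi g <-> ideal_gen (f - g).
Proof.
split=> [/eqP|]; first by rewrite -[_ == _]Quotient.idealrBE => /ideal_genP.
by move/ideal_genP=> fg; apply/eqP; rewrite -[_ == _]Quotient.idealrBE.
Qed.

Lemma alg_piK f : ideal_gen (repr (alg_pi f) - f).
Proof. by apply/alg_piP; rewrite /alg_pi reprK. Qed.

Lemma alg_piD f g : alg_pi (f + g) = alg_pi f + alg_pi g.
Proof. exact: Quotient.pi_add. Qed.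

Lemma alg_pi0 : alg_pi 0 = 0.
Proof. by apply: (addIr (alg_pi 0)); rewrite -alg_piD !add0r. Qed.

Definition alg_quot_mul (u v : Q) : Q := alg_pi (repr u * repr v).
Definition alg_quot_scale (c : K) (u : Q) : Q := alg_pi (c *: repr u).

Let pi_M f g : alg_pi (f * g) = alg_quot_mul (alg_pi f) (alg_pi g).
Proof.
apply/esym/alg_piP; rewrite -[X in ideal_gen X](subrKA (f * repr (alg_pi g))).
rewrite -mulrBl -mulrBr; apply: ideal_genD.
  exact/ideal_genMr/alg_piK.
exact/ideal_genMl/alg_piK.
Qed.

Let pi_Z c f : alg_pi (c *: f) = alg_quot_scale c (alg_pi f).
Proof.
apply/esym/alg_piP; rewrite -scalerBr -mulr_algl.
exact/ideal_genMl/alg_piK.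
Qed.

Fact alg_quot_mulA : associative alg_quot_mul.
Proof.
by elim/alg_piW=> f; elim/alg_piW=> g; elim/alg_piW=> h; rewrite -!pi_M mulrA.
Qed.

Fact alg_quot_mul1r : left_id (alg_pi 1) alg_quot_mul.
Proof. by elim/alg_piW=> f; rewrite -pi_M mul1r. Qed.

Fact alg_quot_mulr1 : right_id (alg_pi 1) alg_quot_mul.
Proof. by elim/alg_piW=> f; rewrite -pi_M mulr1. Qed.

Fact alg_quot_mulDl : left_distributive alg_quot_mul +%R.
Proof.
elim/alg_piW=> f; elim/alg_piW=> g; elim/alg_piW=> h.
by rewrite -alg_piD -!pi_M -alg_piD mulrDl.
Qed.

Fact alg_quot_mulDr : right_distributive alg_quot_mul +%R.
Proof.
elim/alg_piW=> f; elim/alg_piW=> g; elim/alg_piW=> h.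
by rewrite -alg_piD -!pi_M -alg_piD mulrDr.
Qed.

Fact alg_quot_oner_neq0 : alg_pi 1 != 0.
Proof. by apply/eqP; rewrite -alg_pi0 => /alg_piP; rewrite subr0. Qed.

HB.instance Definition _ := GRing.Zmodule_isNzRing.Build Q
  alg_quot_mulA alg_quot_mul1r alg_quot_mulr1 alg_quot_mulDl alg_quot_mulDr
  alg_quot_oner_neq0.

Lemma alg_piM f g : alg_pi (f * g) = alg_pi f * alg_pi g.
Proof. exact: pi_M. Qed.

Fact alg_quot_scalerA (a b : K) (u : Q) :
  alg_quot_scale a (alg_quot_scale b u) = alg_quot_scale (a * b) u.
Proof. by move: u; elim/alg_piW=> f; rewrite -!pi_Z scalerA. Qed.

Fact alg_quot_scale1r : left_id 1 alg_quot_scale.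
Proof. by elim/alg_piW=> f; rewrite -pi_Z scale1r. Qed.

Fact alg_quot_scalerDr : right_distributive alg_quot_scale +%R.
Proof.
move=> a; elim/alg_piW=> f; elim/alg_piW=> g.
by rewrite -alg_piD -!pi_Z -alg_piD scalerDr.
Qed.

Fact alg_quot_scalerDl u : {morph alg_quot_scale^~ u : a b / a + b}.
Proof. by move: u; elim/alg_piW=> f a b; rewrite -!pi_Z -alg_piD scalerDl. Qed.

HB.instance Definition _ := GRing.Zmodule_isLmodule.Build K Q
  alg_quot_scalerA alg_quot_scale1r alg_quot_scalerDr alg_quot_scalerDl.

Lemma alg_piZ c f : alg_pi (c *: f) = c *: alg_pi f.
Proof. exact: pi_Z. Qed.

Fact alg_quot_scalerAl (a : K) (u v : Q) : a *: (u * v) = (a *: u) * v.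
Proof.
move: u v; elim/alg_piW=> f; elim/alg_piW=> g.
by rewrite -alg_piM -!alg_piZ -alg_piM scalerAl.
Qed.

HB.instance Definition _ := GRing.Lmodule_isLalgebra.Build K Q alg_quot_scalerAl.

Fact alg_quot_scalerAr (a : K) (u v : Q) : a *: (u * v) = u * (a *: v).
Proof.
move: u v; elim/alg_piW=> f; elim/alg_piW=> g.
by rewrite -alg_piM -!alg_piZ -alg_piM scalerAr.
Qed.

HB.instance Definition _ := GRing.Lalgebra_isAlgebra.Build K Q alg_quot_scalerAr.

Fact alg_pi_is_zmod_morphism : zmod_morphism alg_pi.
Proof. by move=> f g; rewrite -scaleN1r alg_piD alg_piZ scaleN1r. Qed.

Fact alg_pi_is_monoid_morphism : monoid_morphism alg_pi.
Proof. by split=> // f g; rewrite alg_piM. Qed.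

Fact alg_pi_is_scalable : scalable alg_pi.
Proof. by move=> c f; rewrite alg_piZ. Qed.

HB.instance Definition _ := GRing.isZmodMorphism.Build R Q alg_pi
  alg_pi_is_zmod_morphism.
HB.instance Definition _ := GRing.isMonoidMorphism.Build R Q alg_pi
  alg_pi_is_monoid_morphism.
HB.instance Definition _ := GRing.isScalable.Build K R Q *:%R alg_pi
  alg_pi_is_scalable.

End QuotientAlgebra.

Section OkadaRelators.
Variables (K : fieldType) (N : nat).
Variables (X : 'I_N.-1 -> K) (Y : 'I_N.-2 -> K).
Variables (R : algType K) (e : 'I_N.-1 -> R).

Inductive okada_relator : R -> Prop :=
| okada_relator_sq (i : 'I_N.-1) :
    okada_relator (e i * e i - X i *: e i)
| okada_relator_comm (i j : 'I_N.-1) :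
    ((i + 2 <= j) || (j + 2 <= i))%N -> okada_relator (e i * e j - e j * e i)
| okada_relator_braid (i j : 'I_N.-1) (k : 'I_N.-2) :
    i = k :> nat -> j = (k + 1)%N :> nat ->
    okada_relator (e j * e i * e j - Y k *: e j).

Lemma okada_relator_proper (T : nzRingType) (phi : {rmorphism R -> T}) :
  (forall i, phi (e i) = 0) -> ~ ideal_gen okada_relator 1.
Proof.
move=> e0 /(ideal_gen_ker (phi := phi)).
suff phi0 f : okada_relator f -> phi f = 0.
  by move=> /(_ phi0) /eqP; rewrite rmorph1 oner_eq0.
case=> [i|i j _|i j k _ _].
- by rewrite rmorphB -mulr_algl !rmorphM e0 !mulr0 subr0.
- by rewrite rmorphB !rmorphM !e0 !mulr0 subr0.
- by rewrite rmorphB -mulr_algl !rmorphM !e0 !mulr0 subr0.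
Qed.

End OkadaRelators.

Section OkadaAlgebra.
Variables (K : fieldType) (N : nat).
Variables (X : 'I_N.-1 -> K) (Y : 'I_N.-2 -> K).

Fact okada_proper : ~ ideal_gen (okada_relator X Y (@free_gen K 'I_N.-1)) 1.
Proof.
exact: (okada_relator_proper (phi := @free_const K 'I_N.-1) (@free_const_gen K _)).
Qed.

Definition okada_algebra : Type := alg_quot okada_proper.
HB.instance Definition _ := GRing.Algebra.on okada_algebra.

Definition E_gen (i : 'I_N.-1) : okada_algebra :=
  alg_pi okada_proper (free_gen K i).

Definition E_perm (s : 'S_N) : okada_algebra :=
  \prod_(k <- code_word s) E_gen k.

End OkadaAlgebra.

(* Linear algebra for modules not known beforehand to be finite dimensional. *)
Section Basis.
Variables (K : fieldType) (V : lmodType K).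

Definition lin_indep (I : finType) (b : I -> V) : Prop :=
  forall c : I -> K, \sum_i c i *: b i = 0 -> forall i, c i = 0.

Definition spanning (I : finType) (b : I -> V) : Prop :=
  forall v : V, exists c : I -> K, v = \sum_i c i *: b i.

Definition is_basis (I : finType) (b : I -> V) : Prop := lin_indep b /\ spanning b.

Definition has_dim (n : nat) : Prop := exists b : 'I_n -> V, is_basis b.

End Basis.

(* Main.v *)
Require Import Defs.
From HB Require Import structures.
From Stdlib Require Import Relations.
From mathcomp Require Import all_boot all_fingroup all_algebra zify.
From mathcomp Require Import boolp classical_sets cardinality.
From mathcomp.multinomials Require Import monalg.

(** Write [desc m n] for the descending word (n-1)(n-2)...m in the generator
labels.  The word of a permutation with code c is the product of the runs
desc m_i i for i = 0, ..., N-1, where m_i = i - c_i; so it amounts to the list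
of bottoms [m_(N-1); ...; m_0], and since c_i may take all the values 0, ..., i,
the N! permutations correspond to the N! lists with m_i <= i.

Spanning.  Multiply such a normal form on the right by a generator j, and let
m be the bottom of its last run (n-1)...m.  Either j passes through the run by
commutation and continues below (j+1 < m), or it lengthens the run (j+1 = m),
or it is absorbed by a square (j = m), or j = p+1 > m, and then one braid move
gives
  (desc m n) (p+1) = y_p (desc m p) (desc (p+1) n)     [desc_absorb],
where the letters of desc m p act on the lower runs.  By induction on the
number of runs, every word reduces to a scalar times a normal form
[word_normal_form].  The squares and the braids are only rewritten towards
the shorter word, so that vanishing parameters do no harm; the weighted
reduction [wred] records the scalars, and one argument serves the monoid and
the algebra.

Independence.  The same four cases, read as a definition, give a right action
[act] of the letters on scalars times lists of bottoms: the right regular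
representation of the algebra with n+1 runs, seen as a free left module, with
basis the possible last runs, over the algebra with n runs.  That this action
satisfies the defining relations is proved by induction on n: the relations for
n+1 runs reduce to the relations for n runs and their consequence
[desc_absorb], whence [act_respects].  The normal form with bottoms l sends the
empty normal form to l with coefficient 1 [run_nf].  Hence distinct normal
forms are different in the monoid (all parameters being 1), and in the algebra
the coefficient of l in the result defines a functional on the free algebra
which vanishes on the ideal of relations and isolates one E_sigma
[functional_kills_ideal]. *)

Set Implicit Arguments.
Unset Strict Implicit.
Unset Printing Implicit Defensive.

Import GRing.Theory.
Local Open Scope ring_scope.

(** * Descending runs *)

Definition far (i j : nat) : bool := ((i + 2 <= j) || (j + 2 <= i))%N.

Definition desc (m n : nat) : seq nat := rev (iota m (n - m)).

Lemma desc_cat p m n : (m <= p)%N -> (p <= n)%N ->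
  desc m n = desc p n ++ desc m p.
Proof.
move=> mp pn; rewrite /desc -rev_cat; congr rev.
have -> : (n - m = (p - m) + (n - p))%N by lia.
by rewrite iotaD; congr (_ ++ iota _ _); lia.
Qed.

Lemma desc_nil m : desc m m = [::].
Proof. by rewrite /desc subnn. Qed.

Lemma descSr m n : (m <= n)%N -> desc m n.+1 = n :: desc m n.
Proof.
move=> mn; rewrite (desc_cat mn (leqnSn n)) /desc subSnn /=.
by rewrite -cat1s.
Qed.

Lemma descSl m n : (m < n)%N -> desc m n = rcons (desc m.+1 n) m.
Proof.
by move=> mn; rewrite (desc_cat (leqnSn m) mn) descSr // desc_nil cats1.
Qed.

Lemma mem_desc m n i : (i \in desc m n) = (m <= i < n)%N.
Proof. by rewrite mem_rev mem_iota; lia. Qed.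

Lemma rev_iotaS n : rev (iota 0 n.+1) = n :: rev (iota 0 n).
Proof. by rewrite -addn1 iotaD rev_cat. Qed.

(** * Weighted reduction of words *)

Section WeightedReduction.
Variables (K : comNzRingType) (x y : nat -> K).

(** [wred a u v] stands for u = a v.  It is not symmetric: a step read backwards
would divide by a parameter that may be zero. *)
Inductive wred : K -> seq nat -> seq nat -> Prop :=
| wred_refl w : wred 1 w w
| wred_trans a b u v w : wred a u v -> wred b v w -> wred (a * b) u w
| wred_cat a b u u' v v' :
    wred a u u' -> wred b v v' -> wred (a * b) (u ++ v) (u' ++ v')
| wred_idem i : wred (x i) [:: i; i] [:: i]
| wred_comm i j : far i j -> wred 1 [:: i; j] [:: j; i]
| wred_braid i : wred (y i) [:: i.+1; i; i.+1] [:: i.+1].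

Lemma wred_trans1 a u v w : wred 1 u v -> wred a v w -> wred a u w.
Proof. by move=> uv vw; rewrite -[a]mul1r; apply: wred_trans uv vw. Qed.

Lemma wred_catl a u v v' : wred a v v' -> wred a (u ++ v) (u ++ v').
Proof. by move=> vv; rewrite -[a]mul1r; apply: wred_cat (wred_refl u) vv. Qed.

Lemma wred_catr a u u' v : wred a u u' -> wred a (u ++ v) (u' ++ v).
Proof. by move=> uu; rewrite -[a]mulr1; apply: wred_cat uu (wred_refl v). Qed.

Lemma wred_comm_words u v : allrel far u v -> wred 1 (u ++ v) (v ++ u).
Proof.
elim: u => [|i u IHu] /=; first by rewrite cats0 => _; apply: wred_refl.
rewrite allrel_consl => /andP[iv /IHu uv].
apply: (@wred_trans1 _ _ ([:: i] ++ (v ++ u))); first exact: (wred_catl [:: i]).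
rewrite -(cat1s i u) !catA; apply: wred_catr => {uv IHu}.
elim: v iv => [|j v IHv] /=; first by move=> _; apply: wred_refl.
case/andP=> ij /IHv iv.
apply: (@wred_trans1 _ _ ([:: j; i] ++ v)).
  exact: (wred_catr v (wred_comm ij)).
exact: (wred_catl [:: j] iv).
Qed.

(** The letter p+1 commutes back to the p of the run, where p+1, p, p+1 is a
braid; what is left of the run splits into two commuting runs. *)
Lemma desc_absorb m p n : (m <= p)%N -> (p.+1 < n)%N ->
  wred (y p) (desc m n ++ [:: p.+1]) (desc m p ++ desc p.+1 n).
Proof.
move=> mp pn.
have -> : desc m n = desc p.+2 n ++ [:: p.+1; p] ++ desc m p.
  by rewrite (@desc_cat p.+2 m n) ?descSr //; lia.
rewrite -!catA; apply:
  (@wred_trans1 _ _ (desc p.+2 n ++ [:: p.+1; p] ++ [:: p.+1] ++ desc m p)).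
  do 2!apply: wred_catl; apply: wred_comm_words.
  by apply/allrelP=> i j; rewrite mem_desc inE /far => ? /eqP->; lia.
rewrite -[y p]mulr1; apply: (@wred_trans _ _ _ (desc p.+1 n ++ desc m p)).
  rewrite (descSl pn) cat_rcons; apply: wred_catl.
  exact: (wred_catr (desc m p) (wred_braid p)).
apply: wred_comm_words.
by apply/allrelP=> i j; rewrite !mem_desc /far; lia.
Qed.

(** * Normal forms *)

(** The head of the list is the bottom of the last run; the level of a run is
the number of runs before it. *)
Fixpoint is_code (l : seq nat) : bool :=
  if l is m :: l' then (m <= size l')%N && is_code l' else true.

Fixpoint code_nf (l : seq nat) : seq nat :=
  if l is m :: l' then code_nf l' ++ desc m (size l') else [::].

Lemma unit_is_code n : is_code (rev (iota 0 n)).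
Proof.
by elim: n => // n IHn; rewrite rev_iotaS /= IHn size_rev size_iota leqnn.
Qed.

Lemma unit_nf n : code_nf (rev (iota 0 n)) = [::].
Proof.
by elim: n => // n IHn; rewrite rev_iotaS /= IHn size_rev size_iota desc_nil.
Qed.

(** Induction on the number of runs; an absorbed letter leaves a whole word to
act on the lower runs, so the induction hypothesis is first extended to
words. *)
Lemma nf_rcons l j : is_code l -> (j.+1 < size l)%N ->
  exists a l', [/\ is_code l', size l' = size l &
                   wred a (code_nf l ++ [:: j]) (code_nf l')].
Proof.
suff words n : (forall l j, size l = n -> is_code l -> (j.+1 < n)%N ->
    exists a l', [/\ is_code l', size l' = n &
                   wred a (code_nf l ++ [:: j]) (code_nf l')]).
  by move=> cl jl; apply: words.
elim: n => // n IHn {}l {}j.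
have IHw w k : size k = n -> is_code k -> all (fun i => i.+1 < n)%N w ->
    exists a k', [/\ is_code k', size k' = n &
                   wred a (code_nf k ++ w) (code_nf k')].
  elim: w k => [|i w IHw] k szk ck /=.
    by exists 1, k; rewrite cats0; split=> //; apply: wred_refl.
  case/andP=> iN wN; have [a [k1 [ck1 szk1 red1]]] := IHn k i szk ck iN.
  have [b [k2 [ck2 szk2 red2]]] := IHw k1 szk1 ck1 wN.
  exists (a * b), k2; split=> //; apply: wred_trans red2.
  by rewrite -cat1s catA; apply: wred_catr.
case: l => [|m l] //= [szl]; rewrite szl => /andP[mn cl] jn.
case: (ltngtP j.+1 m) => [jm|jm|jm].
- have [a [l' [cl' szl' red]]] := IHn l j szl cl (leq_trans jm mn).
  exists a, (m :: l'); rewrite /= szl' mn; split=> //; rewrite -catA.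
  apply: (@wred_trans1 _ _ (code_nf l ++ [:: j] ++ desc m n)).
    apply/wred_catl/wred_comm_words.
    by apply/allrelP=> i k; rewrite mem_desc inE /far => ? /eqP->; lia.
  by rewrite catA; apply: wred_catr.
- have [jm'|jm'] := eqVneq j m.
    exists (x m), (m :: l); rewrite /= szl mn; split=> //.
    rewrite -catA jm'; apply: wred_catl.
    rewrite (@descSl m n) -?jm' // cats1 -cats1 -cats1 -catA.
    exact/wred_catl/wred_idem.
  case: j jm jm' jn => [|j] jm jm' jn; first by lia.
  have [|b [l' [cl' szl' red]]] := IHw (desc m j) l szl cl.
    by apply/allP=> i; rewrite mem_desc; lia.
  exists (y j * b), (j.+1 :: l'); rewrite /= szl'; split=> //; first lia.
  rewrite -catA; apply: wred_trans (wred_catr _ red).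
  by rewrite -catA; apply/wred_catl/desc_absorb; lia.
- exists 1, (j :: l); rewrite /= szl -jm; split=> //; first lia.
  by rewrite -catA cats1 -descSl //; apply: wred_refl.
Qed.

(** * The action on weighted codes *)

Definition wcode : Type := K * seq nat.
Implicit Types (s t : wcode) (f : nat -> wcode -> wcode).

Definition scale (a : K) s : wcode := (a * s.1, s.2).
Definition push (m : nat) s : wcode := (s.1, m :: s.2).
Definition run f (w : seq nat) s : wcode := foldl (fun t j => f j t) s w.

(** The right multiplication by the letter j on the last run, when f describes
the right multiplication on the runs below it. *)
Definition act_step f (j : nat) s : wcode :=
  if s.2 is m :: l then
    let t : wcode := (s.1, l) in
    if (j.+1 < m)%N then push m (f j t)
    else if j.+1 == m then push j t
    else if j == m then scale (x j) s
    else push j (scale (y j.-1) (run f (desc m j.-1) t))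
  else (0, [::]).

(** Without runs every letter acts by zero: this satisfies the relations
whatever the parameters and the labels, and so starts the induction on n. *)
Definition act n : nat -> wcode -> wcode :=
  iter n act_step (fun _ _ => (0, [::])).

Definition scalable_act f := forall j a s, f j (scale a s) = scale a (f j s).

Definition respects_wred f :=
  forall a u v, wred a u v -> forall s, run f u s = scale a (run f v s).

Lemma scaleA a b s : scale a (scale b s) = scale (a * b) s.
Proof. by rewrite /scale /= mulrA. Qed.

Lemma scale1 s : scale 1 s = s.
Proof. by case: s => a l; rewrite /scale /= mul1r. Qed.

Lemma push_scale m a s : push m (scale a s) = scale a (push m s).
Proof. by []. Qed.

Lemma run_cat f u v s : run f (u ++ v) s = run f v (run f u s).
Proof. exact: foldl_cat. Qed.

Lemma run_scale f : scalable_act f ->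
  forall w a s, run f w (scale a s) = scale a (run f w s).
Proof. by move=> fZ; elim=> //= j w IHw a s; rewrite fZ IHw. Qed.

Lemma respects_wred_gen f : scalable_act f ->
  (forall i s, f i (f i s) = scale (x i) (f i s)) ->
  (forall i j s, (i + 2 <= j)%N -> f i (f j s) = f j (f i s)) ->
  (forall i s, f i.+1 (f i (f i.+1 s)) = scale (y i) (f i.+1 s)) ->
  respects_wred f.
Proof.
move=> fZ f_idem f_comm f_braid a u v; elim=> {a u v} //=.
- by move=> w s; rewrite scale1.
- by move=> a b u v w _ uv _ vw s; rewrite uv vw scaleA.
- move=> a b u u' v v' _ uu' _ vv' s.
  by rewrite !run_cat uu' vv' run_scale // scaleA mulrC.
- by move=> i j /orP[] ij s; rewrite scale1; [apply/esym|]; apply: f_comm.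
Qed.

Lemma act_step_scale f : scalable_act f -> scalable_act (act_step f).
Proof.
move=> fZ j a [b [|m l]]; first by rewrite /act_step /scale /= mulr0.
rewrite /act_step /=.
have -> : (a * b, l) = scale a (b, l) by [].
case: ifP => _; first by rewrite fZ.
case: ifP => _ //; case: ifP => _; first by rewrite /scale /= mulrCA.
by rewrite run_scale // !scaleA mulrC -scaleA.
Qed.

Section ActStep.
Variable f : nat -> wcode -> wcode.
Hypotheses (fZ : scalable_act f) (fR : respects_wred f).

Lemma act_step0 j a : act_step f j (a, [::]) = (0, [::]).
Proof. by []. Qed.

Lemma act_step_lt j m t : (j.+1 < m)%N ->
  act_step f j (push m t) = push m (f j t).
Proof. by case: t => a l jm; rewrite /act_step /= jm. Qed.

Lemma act_step_pred j t : act_step f j (push j.+1 t) = push j t.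
Proof. by case: t => a l; rewrite /act_step /= ltnn eqxx. Qed.

Lemma act_step_eq j t : act_step f j (push j t) = scale (x j) (push j t).
Proof. by rewrite /act_step /= ltnNge leqnSn /= eqn_leq ltnn /= eqxx. Qed.

Lemma act_step_gt j m t : (m <= j)%N ->
  act_step f j.+1 (push m t) = push j.+1 (scale (y j) (run f (desc m j) t)).
Proof.
case: t => a l mj; rewrite /act_step /=.
by rewrite ifF ?ifF //; apply/negP; lia.
Qed.

Lemma wcode_case s : (exists a, s = (a, [::])) \/ (exists m t, s = push m t).
Proof. by case: s => a [|m l]; [left; exists a|right; exists m, (a, l)]. Qed.

Let g := act_step f.

Lemma act_step_idem i s : g i (g i s) = scale (x i) (g i s).
Proof.
rewrite /g; have [[a ->]|[m [t ->]]] := wcode_case s.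
  by rewrite !act_step0 /scale /= mulr0.
case: (ltngtP i.+1 m) => [im|im|<-].
- by rewrite !act_step_lt //; have := fR (wred_idem i) t => /= ->.
- have [->|im'] := eqVneq i m.
    by rewrite act_step_eq act_step_scale // act_step_eq.
  case: i im im' => [|i] im im'; first by lia.
  by rewrite act_step_gt ?act_step_eq //; lia.
- by rewrite act_step_pred act_step_eq.
Qed.

Lemma run_comm u v s : allrel far u v -> run f (u ++ v) s = run f (v ++ u) s.
Proof. by move=> uv; rewrite (fR (wred_comm_words uv)) scale1. Qed.

Lemma run_comm1 u i s : all (far i) u -> run f u (f i s) = f i (run f u s).
Proof.
move=> iu; have := @run_comm [:: i] u s; rewrite allrel1l => /(_ iu).
by rewrite !run_cat.
Qed.

(** When the smaller letter i meets the run at or above its bottom, the larger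
letter j has pushed a run onto the lower levels, and the identity is one
about that run: a square if i = m, the absorption of i if i > m. *)
Lemma act_step_comm i j s : (i + 2 <= j)%N -> g i (g j s) = g j (g i s).
Proof.
rewrite /g => ij; have [[a ->]|[m [t ->]]] := wcode_case s.
  by rewrite !act_step0.
have gZ := act_step_scale fZ.
have [jm|mj] := ltnP j.+1 m.
  rewrite !act_step_lt //; try lia.
  by congr push; apply: (@run_comm1 [:: i] j); rewrite /= /far; lia.
have [mE|jm] := eqVneq m j.+1.
  by rewrite mE act_step_pred !(@act_step_lt i) ?act_step_pred //; lia.
have [->|jm'] := eqVneq m j.
  by rewrite act_step_eq gZ !(@act_step_lt i) ?act_step_eq //; lia.
case: j => [|j] in ij mj jm jm' *; first by lia.
rewrite act_step_gt; last by lia.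
rewrite act_step_lt; last by lia.
rewrite fZ.
case: (ltngtP i.+1 m) => [im|im|im].
- rewrite act_step_lt // act_step_gt; last by lia.
  by rewrite run_comm1 //; apply/allP=> k; rewrite mem_desc /far; lia.
- have [im'|im'] := eqVneq i m.
    rewrite -im' act_step_eq gZ act_step_gt; last by lia.
    rewrite -[RHS]push_scale; congr push.
    rewrite scaleA [x i * _]mulrC -scaleA; congr scale.
    have -> : desc i j = desc i.+1 j ++ [:: i] by rewrite cats1 -descSl //; lia.
    rewrite run_cat /=; have := fR (wred_idem i) (run f (desc i.+1 j) t).
    exact.
  case: i => [|i] in ij im im' *; first by lia.
  rewrite (@act_step_gt i m) ?act_step_gt; try lia.
  congr push; congr scale.
  rewrite run_scale // -run_cat -(fR (@desc_absorb m i j _ _)) ?run_cat //; lia.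
- rewrite -im act_step_pred act_step_gt; last by lia.
  rewrite (@descSl i) ?cats1 -?cats1 ?run_cat //; lia.
Qed.

Lemma act_step_braid i s : g i.+1 (g i (g i.+1 s)) = scale (y i) (g i.+1 s).
Proof.
rewrite /g; have [[a ->]|[m [t ->]]] := wcode_case s.
  by rewrite !act_step0 /scale /= mulr0.
have gZ := act_step_scale fZ.
have [im|mi] := ltnP i.+2 m.
  rewrite !act_step_lt //; try lia.
  by have := fR (wred_braid i) t => /= ->.
have [->|im] := eqVneq m i.+2.
  by rewrite !act_step_pred act_step_gt // desc_nil.
have [->|im'] := eqVneq m i.+1.
  rewrite act_step_eq !gZ act_step_pred act_step_gt // desc_nil /= push_scale.
  by rewrite scaleA mulrC -scaleA.
rewrite (act_step_gt (m := m)) ?act_step_pred ?act_step_gt //; last by lia.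
by rewrite desc_nil.
Qed.

Lemma act_step_respects : respects_wred (act_step f).
Proof.
apply: respects_wred_gen.
- exact: act_step_scale.
- exact: act_step_idem.
- exact: act_step_comm.
- exact: act_step_braid.
Qed.

End ActStep.

Lemma act_scale n : scalable_act (act n).
Proof.
elim: n => [j a s|n IHn]; first by rewrite /scale /= mulr0.
exact: act_step_scale.
Qed.

Lemma act_respects n : respects_wred (act n).
Proof.
elim: n => [|n IHn]; last by apply: act_step_respects IHn; apply: act_scale.
apply: respects_wred_gen; first exact: (@act_scale 0).
- by move=> i s; rewrite /scale /= mulr0.
- by [].
- by move=> i s; rewrite /scale /= mulr0.
Qed.

Lemma run_desc f m n t : (m <= n)%N ->
  run (act_step f) (desc m n) (push n t) = push m t.
Proof.
elim: n => [|n IHn]; first by rewrite leqn0 => /eqP->.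
rewrite leq_eqVlt => /predU1P[->|mn]; first by rewrite desc_nil.
by rewrite descSr //= act_step_pred IHn.
Qed.

(** All runs empty: the bottom of each run equals its level. *)
Definition unit_code n : wcode := (1, rev (iota 0 n)).

Lemma mem_nf l i : is_code l -> i \in code_nf l -> (i.+1 < size l)%N.
Proof.
elim: l => //= m l IHl /andP[ml cl]; rewrite mem_cat mem_desc.
by case/orP=> [/(IHl cl)|]; lia.
Qed.

(** The letters of the lower runs pass below the still empty last run, and the
letters of the last run then lengthen it one at a time. *)
Lemma run_nf l : is_code l ->
  run (act (size l)) (code_nf l) (unit_code (size l)) = (1, l).
Proof.
elim: l => //= m l IHl /andP[ml cl]; rewrite run_cat.
have -> : unit_code (size l).+1 = push (size l) (unit_code (size l)).
  by rewrite /unit_code rev_iotaS.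
have run_push w t : all (fun i => i.+1 < size l)%N w ->
    run (act (size l).+1) w (push (size l) t) =
    push (size l) (run (act (size l)) w t).
  elim: w t => //= i w IHw t /andP[il wl].
  by rewrite -IHw //= act_step_lt.
rewrite run_push; last by apply/allP=> i /(mem_nf cl).
by rewrite IHl // run_desc.
Qed.

End WeightedReduction.

(** * Permutation codes *)

Section PermutationCodes.
Variable N : nat.
Implicit Types s t : 'S_N.

Lemma card_ord_lt m : (m <= N)%N -> #|[set k : 'I_N | (k < m)%N]| = m.
Proof.
move=> mN; rewrite -sum1dep_card (big_ord_narrow (F := fun=> 1%N) mN).
by rewrite sum1_card card_ord.
Qed.

Lemma code_le s (i : 'I_N) : (code s i <= i)%N.
Proof.
rewrite -[leqRHS](card_ord_lt (ltnW (ltn_ord i))).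
apply: subset_leq_card; apply/fintype.subsetP=> k.
by rewrite !inE => /andP[].
Qed.

(** By induction on i the code determines the relative order of the values of
the inverse permutation at 0, ..., i.  Indeed the k < i with a larger value
than i form an up-set of the order already known on 0, ..., i-1, and an up-set
of a total order is determined by its cardinality. *)
Lemma code_inj s t : code s =1 code t -> s = t.
Proof.
move=> st.
have ne (u : 'S_N) (a b : 'I_N) : (a < b)%N -> (u a == u b :> nat) = false.
  by move=> ab; apply/negP=> /eqP/val_inj/perm_inj abE; rewrite abE ltnn in ab.
have order (i k : 'I_N) : (k < i)%N ->
    ((s^-1)%g i < (s^-1)%g k)%N = ((t^-1)%g i < (t^-1)%g k)%N.
  have [n] := ubnP (i : nat); elim: n i k => // n IHn i k ni ki.
  pose A := [set k : 'I_N | (k < i)%N && ((s^-1)%g i < (s^-1)%g k)%N].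
  pose B := [set k : 'I_N | (k < i)%N && ((t^-1)%g i < (t^-1)%g k)%N].
  suff AB : A = B by move/setP/(_ k): AB; rewrite !inE ki.
  have cAB : #|A| = #|B| := st i.
  have lt_eq (a b : 'I_N) : (a < i)%N -> (b < i)%N ->
      ((s^-1)%g a < (s^-1)%g b)%N = ((t^-1)%g a < (t^-1)%g b)%N.
    move=> ai bi; case: (ltngtP a b) => [ab|ba|/val_inj->]; last by rewrite !ltnn.
      have := IHn b a (leq_trans bi ni) ab.
      have := ne s^-1%g _ _ ab; have := ne t^-1%g _ _ ab; lia.
    by apply: IHn => //; lia.
  (* Two up-sets of a total order are comparable by inclusion. *)
  have [AsB|/fintype.subsetPn[a aA aB]] := boolP (A \subset B).
    by apply/eqP; rewrite eqEcard AsB cAB leqnn.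
  apply/eqP; rewrite eq_sym eqEcard cAB leqnn andbT.
  apply/fintype.subsetP=> b bB; apply: contraT => bA; move: aA aB bA bB.
  rewrite !inE => /andP[ai sia]; rewrite ai /= => tia + /andP[bi tib].
  rewrite bi /= => sib; have := lt_eq b a bi ai.
  have := ne t^-1%g _ _ ai; have := ne s^-1%g _ _ bi; lia.
apply: invg_inj; apply/permP=> i; apply/val_inj.
have rank (u : 'S_N) : u i = #|[set k | (u k < u i)%N]| :> nat.
  rewrite -[LHS](card_ord_lt (ltnW (ltn_ord (u i)))).
  rewrite -[LHS](card_preimset _ (@perm_inj _ u)).
  by apply: eq_card => k; rewrite !inE.
rewrite /= (rank s^-1%g) (rank t^-1%g); apply: eq_card => k; rewrite !inE.
case: (ltngtP k i) => [ki|ik|/val_inj->]; last by rewrite !ltnn.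
  have := order i k ki; have := ne s^-1%g _ _ ki; have := ne t^-1%g _ _ ki; lia.
exact: order.
Qed.

(** Codes are listed from the last run to the first, hence the reversal. *)
Definition perm_code s : seq nat :=
  rev [seq (i - code s i)%N | i : 'I_N <- enum 'I_N].

Lemma size_perm_code s : size (perm_code s) = N.
Proof. by rewrite size_rev size_map size_enum_ord. Qed.

Lemma is_code_rev (r : seq nat) :
  is_code (rev r) = all (fun i => nth 0%N r i <= i)%N (iota 0 (size r)).
Proof.
elim/last_ind: r => // r m IHr.
rewrite rev_rcons /= size_rev IHr size_rcons -[(size r).+1]addn1 iotaD all_cat /=.
rewrite nth_rcons ltnn eqxx andbT andbC; congr (_ && _).
by apply: eq_in_all => i; rewrite mem_iota nth_rcons add0n => /= ->.
Qed.

Lemma nf_rev (r : seq nat) :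
  code_nf (rev r) = flatten [seq desc (nth 0%N r i) i | i <- iota 0 (size r)].
Proof.
elim/last_ind: r => // r m IHr.
rewrite rev_rcons /= size_rev IHr size_rcons -[(size r).+1]addn1 iotaD.
rewrite map_cat flatten_cat /= cats0 nth_rcons ltnn eqxx; congr (flatten _ ++ _).
by apply/eq_in_map => i; rewrite mem_iota nth_rcons add0n => /= ->.
Qed.

Lemma nth_perm_code s (i : 'I_N) :
  nth 0%N [seq (k - code s k)%N | k : 'I_N <- enum 'I_N] i = (i - code s i)%N.
Proof. by rewrite (nth_map i) ?nth_ord_enum // size_enum_ord. Qed.

Lemma perm_codeP s : is_code (perm_code s).
Proof.
rewrite is_code_rev; apply/allP=> i.
rewrite mem_iota size_map size_enum_ord /= => iN.
by rewrite (nth_perm_code s (Ordinal iN)) leq_subr.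
Qed.

Lemma val_code_factor s (i : 'I_N) :
  [seq val k | k <- code_factor s i] = desc (i - code s i) i.
Proof.
rewrite /code_factor /desc map_rev; congr rev.
rewrite -(filter_map _ (fun k => i - code s i <= k < i)%N) val_enum_ord.
have iN : (i <= N.-1)%N by have := ltn_ord i; lia.
apply: (irr_sorted_eq ltn_trans ltnn); rewrite ?iota_ltn_sorted //.
  by rewrite sorted_filter ?iota_ltn_sorted //; apply: ltn_trans.
by move=> k; rewrite mem_filter !mem_iota; lia.
Qed.

Lemma val_code_word s : [seq val k | k <- code_word s] = code_nf (perm_code s).
Proof.
rewrite nf_rev size_map size_enum_ord -val_enum_ord map_flatten.
congr flatten; rewrite -[LHS]map_comp -[RHS]map_comp; apply: eq_map => i /=.
by rewrite val_code_factor nth_perm_code.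
Qed.

Lemma perm_code_inj : injective perm_code.
Proof.
move=> s t /(can_inj revK) st; apply: code_inj => i.
have := nth_perm_code s i; rewrite st nth_perm_code.
by have := code_le s i; have := code_le t i; lia.
Qed.

(** Injectivity and counting: there are N! permutations and N! sequences of
bottoms, the i-th of which takes i + 1 values. *)
Lemma perm_code_surj l : is_code l -> size l = N ->
  exists s : 'S_N, perm_code s = l.
Proof.
rewrite -[l]revK; move: (rev l) => r.
rewrite is_code_rev size_rev => /allP cr szr.
pose F s : {dffun forall i : 'I_N, 'I_i.+1} :=
  [ffun i : 'I_N => inord (code s i) : 'I_i.+1].
have F_inj : injective F.
  move=> s t /ffunP st; apply: code_inj => i; have /(congr1 val) := st i.
  by rewrite !ffunE /= !inordK // ltnS code_le.
have cardF : #|{dffun forall i : 'I_N, 'I_i.+1}| = #|'S_N|.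
  rewrite card_Sn card_dep_ffun foldrE big_map big_enum /=.
  rewrite fact_prod big_add1 big_mkord.
  by apply: eq_bigr => i _; rewrite card_ord.
have [G _ GK] := inj_card_bij F_inj (eq_leq cardF).
pose c : {dffun forall i : 'I_N, 'I_i.+1} :=
  [ffun i : 'I_N => inord (i - nth 0%N r i) : 'I_i.+1].
exists (G c); congr rev; apply: (@eq_from_nth _ 0%N).
  by rewrite size_map size_enum_ord.
rewrite size_map size_enum_ord => i iN.
have := GK c; move/ffunP/(_ (Ordinal iN))/(congr1 val).
rewrite (nth_perm_code _ (Ordinal iN)) !ffunE /=.
rewrite !inordK ?ltnS ?code_le ?leq_subr // => ->.
by rewrite subKn // cr // mem_iota szr.
Qed.

End PermutationCodes.

(** Reductions never create letters, so that a reduction starting from a word in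
the ordinals takes place among such words; P is any interpretation of the
weighted steps. *)
Lemma wred_lift (K : comNzRingType) (x y : nat -> K) (n : nat)
    (P : K -> seq 'I_n -> seq 'I_n -> Prop) :
  (forall w, P 1 w w) ->
  (forall a b u v w, P a u v -> P b v w -> P (a * b) u w) ->
  (forall a b u u' v v', P a u u' -> P b v v' -> P (a * b) (u ++ v) (u' ++ v')) ->
  (forall i : 'I_n, P (x i) [:: i; i] [:: i]) ->
  (forall i j : 'I_n, far i j -> P 1 [:: i; j] [:: j; i]) ->
  (forall i j : 'I_n, j = (i + 1)%N :> nat -> P (y i) [:: j; i; j] [:: j]) ->
  forall a u v, wred x y a u v -> forall w, map val w = u ->
  exists2 w', map val w' = v & P a w w'.
Proof.
move=> Prefl Ptrans Pcat Pidem Pcomm Pbraid a u v; elim=> {a u v}.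
- by move=> u w wu; exists w.
- move=> a b u v w _ IHu _ IHv u1 /IHu[v1 /IHv[w1 <- vw] uv].
  by exists w1 => //; apply: Ptrans uv vw.
- move=> a b u u' v v' _ IHu _ IHv w wE.
  have [u1 u1E uu1] : exists2 w', map val w' = u' & P a (take (size u) w) w'.
    by apply: IHu; rewrite map_take wE take_size_cat.
  have [v1 v1E vv1] : exists2 w', map val w' = v' & P b (drop (size u) w) w'.
    by apply: IHv; rewrite map_drop wE drop_size_cat.
  exists (u1 ++ v1); first by rewrite map_cat u1E v1E.
  by rewrite -(cat_take_drop (size u) w); apply: Pcat.
- move=> i [|j [|k [|? ?]]] //= [ji ki].
  have -> : k = j by apply: val_inj; rewrite /= ji ki.
  by exists [:: j]; rewrite /= -ji.
- move=> i j ij [|i1 [|j1 [|? ?]]] //= [ii jj].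
  by exists [:: j1; i1]; rewrite /= ?ii ?jj //; apply: Pcomm; rewrite ii jj.
- move=> i [|j [|k [|l [|? ?]]]] //= [ji ki li].
  have -> : l = j by apply: val_inj; rewrite /= ji li.
  by exists [:: j]; rewrite /= ?ji // -ki; apply: Pbraid; rewrite ji ki addn1.
Qed.

(** * Reduction to the word of a permutation *)

Section NormalForm.
Variables (K : comNzRingType) (x y : nat -> K) (N : nat).

Lemma word_normal_form (w : seq 'I_N.-1) :
  exists s a, wred x y a [seq val i | i <- w]
                         [seq val i | i <- code_word (s : 'S_N)].
Proof.
suff [l [a [cl szl red]]] : exists l a, [/\ is_code l, size l = N &
    wred x y a [seq val i | i <- w] (code_nf l)].
  have [s sl] := perm_code_surj cl szl.
  by exists s, a; rewrite val_code_word sl.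
elim/last_ind: w => [|w i [l [a [cl szl red]]]].
  exists (rev (iota 0 N)), 1; split; first 1 last.
  - by rewrite size_rev size_iota.
  - by rewrite unit_nf; apply: wred_refl.
  exact: unit_is_code.
have [|b [l' [cl' szl' red']]] := nf_rcons x y cl (_ : i.+1 < size l)%N.
  by rewrite szl; have := ltn_ord i; lia.
exists l', (a * b); split=> //; first by rewrite szl'.
by rewrite map_rcons -cats1; apply: wred_trans (wred_catr _ red) red'.
Qed.

Lemma run_code_word (s : 'S_N) :
  run (act x y N) [seq val i | i <- code_word s] (unit_code K N) =
  (1, perm_code s).
Proof.
by have := run_nf x y (perm_codeP s); rewrite size_perm_code val_code_word.
Qed.

End NormalForm.

Lemma perm_index_bij N : exists p : 'I_N`! -> 'S_N, bijective p.
Proof.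
exists (enum_val \o cast_ord (esym (card_Sn N))).
apply: bij_comp (@enum_val_bij _) _.
exact: Bijective (cast_ordK _) (cast_ordKV _).
Qed.

(** * The Okada monoid *)

Section Monoid.
Variable N : nat.
Local Open Scope quotient_scope.

Lemma okada_rel_congr w w' : @okada_rel N w w' -> okada_congr w w'.
Proof.
move=> ww'; rewrite -[w]cats0 -[w']cats0.
exact/rst_step/(OkadaStep [::] [::] ww').
Qed.

(** With all parameters equal to 1 every reduction step has weight 1 and can be
read in both directions, so the action respects the full congruence. *)
Lemma okada_congr_run (u v : seq 'I_N.-1) : okada_congr u v ->
  forall t, run (act (fun=> 1 : rat) (fun=> 1) N) [seq val i | i <- u] t =
            run (act (fun=> 1 : rat) (fun=> 1) N) [seq val i | i <- v] t.
Proof.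
elim=> {u v} [_ _ [u v w w' ww'] t|//|u v _ uv t|u v w _ uv _ vw t].
- rewrite !map_cat !run_cat; congr (run _ _); rewrite -[RHS]scale1.
  apply: act_respects; case: {u v t} ww' => [i|i j ij|i j /= ->].
  + exact: wred_idem.
  + exact: wred_comm.
  + by rewrite addn1; apply: (@wred_braid _ (fun=> 1)).
- by rewrite uv.
- by rewrite uv vw.
Qed.

Lemma e_permE (s : 'S_N) : e_perm s = \pi_(okada_monoid N) (code_word s).
Proof.
rewrite /e_perm; elim: (code_word s) => [|i w IHw]; first by rewrite big_nil.
by rewrite big_cons IHw -cat1s okada_pi_cat.
Qed.

Lemma e_perm_inj : injective (@e_perm N).
Proof.
move=> s t; rewrite !e_permE => /eqP/okada_piP/okada_congr_run st.
apply: perm_code_inj; have := st (unit_code _ N).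
by rewrite !run_code_word; case.
Qed.

Lemma e_perm_surj (z : okada_monoid N) : exists s, e_perm s = z.
Proof.
elim/quotW: z => w.
have [s [a red]] := word_normal_form (fun=> 1 : rat) (fun=> 1) w.
have [|||||||w' /(inj_map val_inj) -> ww'] :=
  @wred_lift _ _ _ _ (fun _ : rat => @okada_congr N) _ _ _ _ _ _ _ _ _ red w.
- by move=> u; apply: rst_refl.
- by move=> _ _ u v t; apply: rst_trans.
- by move=> _ _ u u' v v'; apply: okada_congr_cat.
- by move=> i; apply/okada_rel_congr/okada_rel_idem.
- by move=> i j ij; apply/okada_rel_congr/okada_rel_comm.
- by move=> i j ij; apply/okada_rel_congr/okada_rel_braid.
- by [].
by exists s; rewrite e_permE; apply/eqP/okada_piP; apply: rst_sym.
Qed.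

Lemma e_perm_bij : bijective (@e_perm N).
Proof.
have [g gK] := choice e_perm_surj.
by exists g => // s; apply: e_perm_inj.
Qed.

Lemma okada_monoid_card : ([set: okada_monoid N] #= `I_(N`!))%card.
Proof.
have [p p_bij] := perm_index_bij N.
have -> : ([set: okada_monoid N] =
            (e_perm (N := N) \o p) @` [set: 'I_N`!])%classic.
  apply/seteqP; split=> // z _; have [s <-] := e_perm_surj z.
  by case: p_bij => q _ qK; exists (q s); rewrite //= qK.
rewrite (card_eqr card_II); apply: inj_card_eq => i j _ _.
by move=> /e_perm_inj/(bij_inj p_bij).
Qed.

End Monoid.

(** * Functionals on the free algebra *)

Section FreeAlgebraMonomials.
Variables (K : fieldType) (G : choiceType).
Local Notation A := (free_alg K G).

Definition mon (w : seq G) : A := \prod_(k <- w) free_gen K k.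

Lemma mon_cat u v : mon (u ++ v) = mon u * mon v.
Proof. exact: big_cat. Qed.

Lemma malg_scaleU (c a : K) (m : {fmonom G}) :
  (c *: << a *g m >> : {malg K[{fmonom G}]}) = << c * a *g m >>.
Proof. by apply/malgP=> k; rewrite mcoeffZ !mcoeffU mulrnAr. Qed.

Lemma monE w : mon w = << FMonom w >>.
Proof.
elim: w => [|i w IHw]; first by rewrite /mon big_nil -fmoneE.
rewrite -cat1s mon_cat IHw /mon big_seq1 /free_gen.
rewrite [LHS](fgmulUU 1 1) mul1r; congr (<< _ *g _ >>).
by apply: val_inj; rewrite /= fmM fmU.
Qed.

Lemma free_algE (f : A) : exists (r : seq (seq G)) (c : seq G -> K),
  f = \sum_(w <- r) c w *: mon w.
Proof.
exists [seq val m | m <- finmap.enum_fset (msupp f)],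
  (fun w => mcoeff (FMonom w) f).
rewrite big_map [LHS]monalgE.
by apply: eq_bigr => m _; rewrite monE fmK malg_scaleU mulr1.
Qed.

Lemma free_functional (h : seq G -> K) :
  exists F : {scalar A}, forall w, F (mon w) = h w.
Proof.
pose F : A -> K := mmap idfun (fun m : {fmonom G} => h m).
have FD : {morph F : f g / f + g} := @mmapD _ _ _ idfun _.
have F_scalar : scalar F.
  move=> c f g; rewrite FD; congr (_ + _); rewrite [f]monalgE scaler_sumr.
  have F_sum r (k : {fmonom G} -> {malg K[{fmonom G}]}) :
      F (\sum_(m <- r) k m) = \sum_(m <- r) F (k m).
    exact: raddf_sum.
  rewrite !F_sum mulr_sumr; apply: eq_bigr => m _.
  by rewrite malg_scaleU /F !mmapU mulrA.
pose F_linear := GRing.isLinear.Build K A K *%R F F_scalar.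
pose F' : {scalar A} := HB.pack F F_linear.
by exists F' => w; rewrite /= /F monE mmapU mul1r.
Qed.

End FreeAlgebraMonomials.

Lemma add_combination (K : fieldType) (V : lmodType K) (I : finType)
    (b : I -> V) (i : I) (a : K) (c : I -> K) :
  exists d : I -> K, \sum_j d j *: b j = a *: b i + \sum_j c j *: b j.
Proof.
exists (fun j => (if j == i then a else 0) + c j).
under eq_bigr do rewrite scalerDl.
rewrite big_split /=; congr (_ + _).
by rewrite (bigD1 i) //= eqxx big1 ?addr0 // => j /negPf->; rewrite scale0r.
Qed.

(** Reductions have parameters indexed by all the naturals; the value 0 outside
the range is never reached from words in the ordinals. *)
Definition extend0 (K : nzRingType) n (Z : 'I_n -> K) (i : nat) : K :=
  oapp Z 0 (insub i).

Lemma extend0E (K : nzRingType) n (Z : 'I_n -> K) (i : 'I_n) :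
  extend0 Z i = Z i.
Proof. by rewrite /extend0 valK. Qed.

Section IdealFunctional.
Variables (K : fieldType) (N : nat) (X : 'I_N.-1 -> K) (Y : 'I_N.-2 -> K).
Variables (R : algType K) (e : 'I_N.-1 -> R).
Local Notation word w := (\prod_(k <- w) e k).

(** The condition that F vanish on all [word u * f * word v] is stable under the
operations that generate the ideal, because words span the algebra. *)
Lemma functional_kills_ideal (F : {scalar R}) :
  (forall f : R, exists (r : seq (seq 'I_N.-1)) (c : seq 'I_N.-1 -> K),
     f = \sum_(w <- r) c w *: word w) ->
  (forall a u v w w',
     wred (extend0 X) (extend0 Y) a
       [seq val i | i <- w] [seq val i | i <- w'] ->
     F (word (u ++ w ++ v)) = a * F (word (u ++ w' ++ v))) ->
  forall f, ideal_gen (okada_relator X Y e) f -> F f = 0.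
Proof.
move=> e_span F_red f If.
have rel u v w w' a :
    wred (extend0 X) (extend0 Y) a [seq val i | i <- w] [seq val i | i <- w'] ->
    F (word u * (word w - a *: word w') * word v) = 0.
  move=> /F_red red; rewrite mulrBr mulrBl -scalerAr -scalerAl linearB linearZ.
  by rewrite -!big_cat -!catA /= red subrr.
suff ctx u v : F (word u * f * word v) = 0.
  by have := ctx [::] [::]; rewrite !big_nil mul1r mulr1.
elim: If u v => {f} [f Sf|//|f g _ If _ Ig|f g _ Ig|f g _ If] u v.
- have word2 i j : word [:: i; j] = e i * e j by rewrite big_cons big_seq1.
  case: Sf => [i|i j ij|i j k ik jk].
  + have := rel u v [:: i; i] [:: i] (X i).
    by rewrite word2 big_seq1; apply; rewrite -extend0E; apply: wred_idem.
  + have := rel u v [:: i; j] [:: j; i] 1; rewrite scale1r.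
    by rewrite !word2; apply; apply: wred_comm.
  + have := rel u v [:: j; i; j] [:: j] (Y k).
    rewrite big_cons word2 big_seq1 mulrA; apply.
    rewrite /= jk ik -extend0E addn1; exact: wred_braid.
- by rewrite mulr0 mul0r linear0.
- by rewrite mulrDr mulrDl linearD If Ig addr0.
- have [r [c ->]] := e_span f; rewrite mulr_suml mulr_sumr mulr_suml linear_sum.
  rewrite big1 // => w _; rewrite -scalerAl -scalerAr -scalerAl linearZ /=.
  by rewrite mulrA -big_cat Ig mulr0.
- have [r [c ->]] := e_span g; rewrite !mulr_sumr mulr_suml linear_sum.
  rewrite big1 // => w _; rewrite -!scalerAr -scalerAl linearZ /=.
  by rewrite mulrA -(mulrA _ (word w)) -big_cat If mulr0.
Qed.

End IdealFunctional.

(** * The Okada algebra *)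

Section Algebra.
Variables (K : fieldType) (N : nat) (X : 'I_N.-1 -> K) (Y : 'I_N.-2 -> K).
Local Notation A := (free_alg K 'I_N.-1).
Local Notation O := (okada_algebra X Y).

Local Notation x := (extend0 X).
Local Notation y := (extend0 Y).

Definition E_word (w : seq 'I_N.-1) : O := \prod_(k <- w) E_gen X Y k.

Definition okada_pi (f : A) : O := alg_pi (@okada_proper K N X Y) f.

Lemma okada_pi0 : okada_pi 0 = 0. Proof. exact: alg_pi0. Qed.

Lemma okada_piD f g : okada_pi (f + g) = okada_pi f + okada_pi g.
Proof. exact: alg_piD. Qed.

Lemma okada_piZ c f : okada_pi (c *: f) = c *: okada_pi f.
Proof. exact: alg_piZ. Qed.

Lemma okada_pi_surj v : exists f, v = okada_pi f.
Proof. by elim/alg_piW: v => f; exists f. Qed.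

Lemma E_wordE w : E_word w = okada_pi (mon K w).
Proof. by rewrite /okada_pi /mon rmorph_prod. Qed.

Lemma okada_pi_sum (I : Type) (r : seq I) (c : I -> K) (m : I -> seq 'I_N.-1) :
  okada_pi (\sum_(i <- r) c i *: mon K (m i)) =
  \sum_(i <- r) c i *: E_word (m i).
Proof.
elim: r => [|i r IHr]; first by rewrite !big_nil okada_pi0.
by rewrite !big_cons okada_piD IHr okada_piZ E_wordE.
Qed.

Lemma E_word_cat u v : E_word (u ++ v) = E_word u * E_word v.
Proof. exact: big_cat. Qed.

Lemma E_relator f g : okada_relator X Y (@free_gen K 'I_N.-1) (f - g) ->
  okada_pi f = okada_pi g.
Proof. by move=> fg; apply/alg_piP/ideal_gen_in. Qed.

Lemma E_word_normal_form w : exists (s : 'S_N) a, E_word w = a *: E_perm X Y s.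
Proof.
have [s [a red]] := word_normal_form x y w; exists s, a.
have [|||||||w' /(inj_map val_inj) -> //] :=
  @wred_lift _ _ _ _ (fun a u v => E_word u = a *: E_word v)
    _ _ _ _ _ _ _ _ _ red w.
- by move=> u; rewrite scale1r.
- by move=> b c u v t -> ->; rewrite scalerA.
- move=> b c u u' v v'; rewrite !E_word_cat => -> ->.
  by rewrite -scalerAl -scalerAr scalerA.
- move=> i; rewrite extend0E !E_wordE -okada_piZ; apply: E_relator.
  by rewrite /mon !big_cons !big_nil !mulr1; apply: okada_relator_sq.
- move=> i j ij; rewrite scale1r !E_wordE; apply: E_relator.
  by rewrite /mon !big_cons !big_nil !mulr1; apply: okada_relator_comm.
- move=> i j ij; have iN : (i < N.-2)%N by have := ltn_ord j; rewrite ij; lia.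
  rewrite !E_wordE -okada_piZ; apply: E_relator.
  rewrite -[nat_of_ord i]/(nat_of_ord (Ordinal iN)) extend0E.
  rewrite /mon !big_cons !big_nil !mulr1 mulrA.
  exact: okada_relator_braid.
- by [].
Qed.

Lemma E_perm_spanning : spanning (E_perm X Y).
Proof.
move=> v; have [f ->] := okada_pi_surj v; have [r [c ->]] := free_algE f.
rewrite okada_pi_sum; elim: r => [|m r [d IHr]].
  by exists (fun=> 0); rewrite big_nil big1 // => s _; rewrite scale0r.
have [s [a Em]] := E_word_normal_form m.
rewrite big_cons IHr Em scalerA.
have [d' d'E] := add_combination (E_perm X Y) s (c m * a) d.
by exists d'; apply: esym d'E.
Qed.

(** The functional attached to s0 sends a word to the weight with which it
carries the empty normal form to the code of s0, and to 0 if the result has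
another code. *)
Lemma E_perm_lin_indep : lin_indep (E_perm X Y).
Proof.
move=> c; pose f : A := \sum_s c s *: mon K (code_word s).
have -> : \sum_s c s *: E_perm X Y s = okada_pi f.
  by rewrite okada_pi_sum.
rewrite -okada_pi0 => /alg_piP; rewrite subr0 => If s0.
pose h (w : seq 'I_N.-1) : K :=
  let t := run (act x y N) [seq val i | i <- w] (unit_code K N) in
  if t.2 == perm_code s0 then t.1 else 0.
have [F Fh] := free_functional h.
have : F f = 0.
  apply: functional_kills_ideal If => [|a u v w w' red]; first exact: free_algE.
  rewrite -/(mon K (u ++ w ++ v)) -/(mon K (u ++ w' ++ v)) !Fh /h !map_cat.
  have redC := wred_catl [seq val i | i <- u]
    (wred_catr [seq val i | i <- v] red).
  by rewrite (act_respects N redC) /=; case: ifP; rewrite ?mulr0.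
have -> : F f = \sum_s c s * F (mon K (code_word s)).
  by rewrite linear_sum; apply: eq_bigr => s _; rewrite linearZ.
rewrite (bigD1 s0) //= Fh /h run_code_word /= eqxx mulr1 big1 ?addr0 //.
move=> s ss0; rewrite Fh /h run_code_word /=.
by rewrite (inj_eq (@perm_code_inj N)) (negPf ss0) mulr0.
Qed.

Lemma E_perm_basis : is_basis (E_perm X Y).
Proof. by split; [apply: E_perm_lin_indep|apply: E_perm_spanning]. Qed.

End Algebra.

Lemma is_basis_reindex (K : fieldType) (V : lmodType K) (I J : finType)
    (b : I -> V) (p : J -> I) :
  bijective p -> is_basis b -> is_basis (b \o p).
Proof.
move=> [q pK qK] [b_free b_span]; split=> [c c0 j|v].
  rewrite -[j]pK; apply: (b_free (c \o q)); rewrite -[RHS]c0.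
  rewrite (reindex p) /=; last by apply: onW_bij; exists q.
  by apply: eq_bigr => i _; rewrite pK.
have [c ->] := b_span v; exists (c \o p).
by rewrite (reindex p) //; apply: onW_bij; exists q.
Qed.

Theorem theorem3p20 :
  (forall N : nat,
     ([set: okada_monoid N] #= `I_(N`!))%card
     /\ bijective (@e_perm N))
  /\ (forall (N : nat) (K : fieldType) (X : 'I_N.-1 -> K) (Y : 'I_N.-2 -> K),
        has_dim (okada_algebra X Y) N`!
        /\ is_basis (E_perm X Y)).
Proof.
split=> [N|N K X Y].
  by split; [apply: okada_monoid_card|apply: e_perm_bij].
have [p p_bij] := perm_index_bij N.
split; last exact: E_perm_basis.
by exists (E_perm X Y \o p); apply: is_basis_reindex p_bij (E_perm_basis X Y).
Qed.
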